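(* Let $k$ be a non-negative integer and $n$ a positive integer. Let $p_1, p_2,\ldots,p_{k+1}$ be primes such that $p_i \not\equiv 1 \pmod{12}$ for each $1 \leq i \leq k+1$. Then for any integer $j \not\equiv 0 \pmod{p_{k+1}}$, we have $$B_{2} \left( p_1^2 p_2^2 \cdots p_k^2 p_{k+1}^2 n + \frac{p_1^2 p_2^2 \cdots p_k^2 p_{k+1}\left(12j+ p_{k+1}\right)-1}{12} \right) \equiv 0 \pmod4.$$
   Context: A partition is $2$-regular if none of its parts is even. $B_2(n)$ denotes the number of ordered pairs $(\lambda,\mu)$ of $2$-regular partitions whose parts together sum to $n$; equivalently $\sum_{n\ge0}B_2(n)q^n=\frac{(q^2;q^2)_\infty^2}{(q;q)_\infty^2}$, where $(q^k;q^k)_\infty=\prod_{i\ge1}(1-q^{ki})$. *)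

(* Defs.v *)
From mathcomp Require Import all_boot all_order all_algebra.
Set Implicit Arguments.
Unset Strict Implicit.
Unset Printing Implicit Defensive.
Import Order.TTheory GRing.Theory Num.Theory.

Definition is_partition (s : seq nat) : bool := sorted geq s && (0 \notin s).

Definition regular (l : nat) (s : seq nat) : bool :=
  all (fun m => ~~ (l %| m)) s.

Definition is_regular_pair (n : nat) (lm : seq nat * seq nat) : bool :=
  [&& is_partition lm.1 && regular 2 lm.1,
      is_partition lm.2 && regular 2 lm.2
    & sumn lm.1 + sumn lm.2 == n].

Definition seq_of_bseq (n : nat) (b : n.-bseq 'I_n.+1) : seq nat :=
  [seq nat_of_ord i | i <- b].

(* Two partitions with total size n have at most n parts each, all at most n,
   so restricting to the finite type of sequences of length at most n with
   entries in {0, ..., n} loses no pair: see size_regular_pairs. *)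
Definition B2_nat (n : nat) : nat :=
  #|[set lm : n.-bseq 'I_n.+1 * n.-bseq 'I_n.+1 |
      is_regular_pair n (seq_of_bseq lm.1, seq_of_bseq lm.2)]|.

(* B_2 extended by zero outside the nonnegative integers: no pair of partitions
   has a negative or fractional total size. *)
Definition B2 (x : rat) : nat :=
  if x \is a Num.nat then B2_nat (Num.truncn x) else 0.

Lemma seq_of_bseq_inj n : injective (@seq_of_bseq n).
Proof. by move=> b c /(inj_map val_inj)/val_inj. Qed.

Lemma partition_bseq n s :
  is_partition s -> sumn s <= n -> exists b : n.-bseq 'I_n.+1, seq_of_bseq b = s.
Proof.
case/andP=> _ s0 sn.
have ss : size s <= n.
  apply: leq_trans sn; elim: s s0 => //= x s IH.
  rewrite inE negb_or eq_sym -lt0n => /andP[x0 /IH h].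
  by rewrite -add1n leq_add.
have sx x : x \in s -> x < n.+1.
  move=> xs; rewrite ltnS; apply: leq_trans sn.
  elim: s {s0 ss} xs => //= y s IH; rewrite inE => /orP[/eqP->|/IH h].
    exact: leq_addr.
  exact: leq_trans h (leq_addl _ _).
have mk : size [seq (inord x : 'I_n.+1) | x <- s] <= n by rewrite size_map.
exists (Bseq mk); rewrite /seq_of_bseq /= -map_comp -[RHS]map_id.
by apply/eq_in_map => x /sx xn /=; rewrite inordK.
Qed.

Lemma size_regular_pairs n (L : seq (seq nat * seq nat)) :
  uniq L -> (forall lm, (lm \in L) = is_regular_pair n lm) ->
  size L = B2_nat n.
Proof.
move=> uL inL; rewrite /B2_nat cardE.
set A := [set _ | _].
pose f (lm : n.-bseq 'I_n.+1 * n.-bseq 'I_n.+1) :=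
  (seq_of_bseq lm.1, seq_of_bseq lm.2).
have fI : injective f.
  by move=> [a b] [c d] [/seq_of_bseq_inj -> /seq_of_bseq_inj ->].
rewrite -(size_map f); apply: perm_size; apply: uniq_perm => //.
  by rewrite map_inj_uniq ?enum_uniq.
move=> [s t]; rewrite inL; apply/idP/mapP => [H|[x + ->]]; last first.
  by rewrite mem_enum inE.
case/and3P: (H) => /= /andP[ps _] /andP[pt _] /eqP st.
have [b bs] := @partition_bseq n s ps ltac:(by rewrite -st leq_addr).
have [c ct] := @partition_bseq n t pt ltac:(by rewrite -st leq_addl).
exists (b, c); last by rewrite /f /= bs ct.
by rewrite mem_enum inE /= bs ct.
Qed.

(* Main.v *)
Require Import Defs.
From mathcomp Require Import all_boot all_order all_algebra all_field.
From mathcomp Require Import zify ring.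
Set Implicit Arguments.
Unset Strict Implicit.
Unset Printing Implicit Defensive.
Import Order.TTheory GRing.Theory Num.Theory.

(* By Euler's identity the generating function of [B2_nat] is the square of
   D = \prod_i (1 + q^i). Put F = \prod_i (1 - q^i). Modulo 4 there are two
   expressions for D^2:
   - D^2 = F^2, because D = F modulo 2;
   - D^2 = F(q^2) (1 + 2 \sum_(i > 0) q^(i^2)), because D F = F(q^2) and
     D / F = \prod_i (1 + q^i) / (1 - q^i).
   Since F is supported on the pentagonal numbers, B_2(N) <> 0 modulo 4 forces
   both 2 (12 N + 1) = x^2 + y^2 and 12 N + 1 = x^2 + 3 (2 y)^2. For a prime
   p = 5, 7 or 11 modulo 12 one of the two forms is anisotropic modulo p, so the
   p-adic valuation of 12 N + 1 is even; for the N of the theorem and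
   p = p_(k+1) it is odd. If p_(k+1) is 2 or 3, the argument of [B2] is not an
   integer. *)

(** * Enumeration of partitions into odd parts *)

Definition odd_partition (m n : nat) (s : seq nat) : bool :=
  [&& sorted geq s, all (fun x => odd x && (x <= m)) s & sumn s == n].

(** [fuel] bounds [m + n], which drops at each call: either the largest allowed part is lowered or a
    part [m] is removed. With no fuel left, [m = n = 0]. *)
Fixpoint odd_partitions (fuel m n : nat) : seq (seq nat) :=
  if fuel is k.+1 then
    if m is m'.+1 then
      odd_partitions k m' n ++
      (if odd m && (m <= n) then
         [seq m :: s | s <- odd_partitions k m (n - m)] else [::])
    else if n == 0 then [:: [::]] else [::]
  else [:: [::]].

Lemma odd_partition0 n s : odd_partition 0 n s = (s == [::]) && (n == 0).
Proof.
case: s => [|x s]; rewrite /odd_partition /= 1?eq_sym // andbC.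
by case: x => [|x] //=; rewrite andbF.
Qed.

(** Split by whether the largest part, which is the head, equals [m.+1]. *)
Lemma odd_partition_recl m n s :
  odd_partition m.+1 n s = odd_partition m n s ||
    [&& odd m.+1, m.+1 <= n, head 0 s == m.+1 &
        odd_partition m.+1 (n - m.+1) (behead s)].
Proof.
case: s => [|x s]; first by rewrite /odd_partition /= !andbF orbF.
rewrite /odd_partition [head _ _]/= [behead _]/=.
have geq_trans : transitive geq by move=> a b c /= h1 h2; apply: leq_trans h2 h1.
rewrite ![sorted _ (x :: s)]path_sortedE // ![all _ (x :: s)]/= ![sumn (x :: s)]/=.
case: (eqVneq x m.+1) => [->|xm].
  rewrite ltnn leqnn !andbF /= ?andbF ?andbT.
  have -> : (m.+1 + sumn s == n) = (m.+1 <= n) && (sumn s == n - m.+1) by lia.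
  case h : (all (fun x => odd x && _) s); rewrite ?andbF ?andbT //.
  have -> : all (geq m.+1) s by apply/allP => y /(allP h) /= /andP[].
  by case: (odd _); case: (sorted _ _); case: (m < n).
rewrite !andbF orbF; have -> : (x <= m.+1) = (x <= m) by lia.
case xm' : (x <= m); last by rewrite !andbF.
case xs : (all (geq x) s) => //=.
congr [&& _, _ & _]; congr (_ && _); apply: eq_in_all => y /(allP xs) /= yx.
by congr (_ && _); lia.
Qed.

Lemma mem_odd_partitions k m n s : m + n <= k ->
  (s \in odd_partitions k m n) = odd_partition m n s.
Proof.
elim: k m n s => [|k IH] m n s.
  rewrite leqn0 addn_eq0 => /andP[/eqP-> /eqP->].
  by rewrite odd_partition0 andbT inE.
case: m => [|m] mn.
  by rewrite odd_partition0 /=; case: (n == 0); rewrite ?inE ?andbT ?andbF.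
rewrite [odd_partitions _ _ _]/= mem_cat IH; last by lia.
rewrite odd_partition_recl; congr (_ || _).
rewrite -[~~ odd m]/(odd m.+1) andbA.
case: ifP => // /andP[_ mn']; rewrite andTb.
apply/mapP/andP => [[t + ->]|[/eqP h o]].
  by rewrite IH ?eqxx //; lia.
case: s h o => [|x s] /= h o; first by [].
by exists s; rewrite ?IH ?h //; lia.
Qed.

Lemma uniq_odd_partitions k m n : m + n <= k -> uniq (odd_partitions k m n).
Proof.
elim: k m n => [|k IH] m n //.
case: m => [|m] mn; first by rewrite /=; case: eqP.
rewrite [odd_partitions _ _ _]/= cat_uniq IH; last by lia.
rewrite -[~~ odd m]/(odd m.+1).
case: ifP => // /andP[_ mn']; rewrite map_inj_uniq; last by move=> ? ? [].
rewrite IH; last by lia.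
rewrite andbT; apply/hasPn => s /mapP[t _ ->].
rewrite [~~ _]/(m.+1 :: t \notin _) mem_odd_partitions; last by lia.
by rewrite /odd_partition /= ltnn !andbF.
Qed.

Definition odd_partition_count (m n : nat) : nat :=
  size (odd_partitions (m + n) m n).

Lemma size_odd_partitions k m n : m + n <= k ->
  size (odd_partitions k m n) = odd_partition_count m n.
Proof.
move=> mn; apply/perm_size/uniq_perm; rewrite ?uniq_odd_partitions // => s.
by rewrite !mem_odd_partitions.
Qed.

Lemma odd_partition_count0 n : odd_partition_count 0 n = (n == 0).
Proof. by case: n. Qed.

Lemma odd_partition_countS m n :
  odd_partition_count m.+1 n =
  odd_partition_count m n +
  (if odd m.+1 && (m.+1 <= n) then odd_partition_count m.+1 (n - m.+1) else 0).
Proof.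
rewrite {1}/odd_partition_count addSn [odd_partitions _ _ _]/= size_cat; congr (_ + _).
rewrite -[~~ odd m]/(odd m.+1).
by case: ifP => // /andP[_ mn]; rewrite size_map size_odd_partitions //; lia.
Qed.

Lemma odd_partitionE m n s : n <= m ->
  odd_partition m n s = [&& is_partition s, regular 2 s & sumn s == n].
Proof.
move=> nm; rewrite /odd_partition /is_partition /regular.
rewrite -andbA; congr (_ && _); rewrite andbA.
have [sn|] := eqVneq (sumn s) n; last by rewrite !andbF.
rewrite !andbT -has_pred1 -all_predC -all_predI.
apply: eq_in_all => x xs /=; rewrite dvdn2 negbK.
have -> : (x <= m); last by rewrite andbT; case: x {xs}.
apply: leq_trans nm; rewrite -sn.
elim: s xs {sn} => //= y s IH; rewrite inE => /orP[/eqP->|/IH]; lia.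
Qed.

(** A bound [m >= n] on the parts excludes nothing; sharing it over all [a] makes the sum a
    coefficient of the square of one series. *)
Lemma B2_nat_convolution m n : n <= m ->
  B2_nat n = \sum_(a < n.+1) odd_partition_count m a * odd_partition_count m (n - a).
Proof.
move=> nm; pose P a := odd_partitions (m + a) m a.
pose L := [seq st | a <- iota 0 n.+1, st <- [seq (s, t) | s <- P a, t <- P (n - a)]].
have inP a s : (s \in P a) = odd_partition m a s by rewrite mem_odd_partitions.
have inL a st : st \in [seq (s, t) | s <- P a, t <- P (n - a)] ->
    odd_partition m a st.1 /\ odd_partition m (n - a) st.2.
  by case/allpairsP => -[s t] /= []; rewrite !inP => ? ? ->.
rewrite -(@size_regular_pairs n L).
- rewrite size_allpairs_dep sumnE big_map -/(index_iota 0 n.+1) big_mkord.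
  by apply: eq_bigr => a _; rewrite size_allpairs.
- apply: allpairs_uniq_dep => [|a _|]; first exact: iota_uniq.
    apply: allpairs_uniq; rewrite ?uniq_odd_partitions //.
    by move=> [? ?] [? ?] _ _ [-> ->].
  move=> x x' /allpairsPdep[a [u [_ hu ->]]] /allpairsPdep[a' [u' [_ hu' ->]]] /= e.
  subst u'.
  (* The sum of the first component recovers [a], so the blocks of [L] are disjoint. *)
  have [/and3P[_ _ /eqP ea] _] := inL _ _ hu.
  have [/and3P[_ _ /eqP ea'] _] := inL _ _ hu'.
  by rewrite -ea -ea'.
move=> [s t]; apply/allpairsPdep/and3P.
  move=> [a [st [+ hst e]]]; subst st; have := inL _ _ hst.
  rewrite mem_iota => -[] /= + + an.
  rewrite !odd_partitionE; try lia.
  by move=> /and3P[-> -> /eqP ->] /and3P[-> -> /eqP ->]; split => //; lia.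
move=> [/andP[ps rs] /andP[pt rt] /eqP st].
rewrite /= in ps rs pt rt st; exists (sumn s), (s, t).
split => //; first by rewrite mem_iota; lia.
apply/allpairsP; exists (s, t); split=> //=; rewrite inP odd_partitionE ?ps ?rs ?pt ?rt /=; lia.
Qed.

(** * Binary quadratic forms anisotropic modulo p *)

Lemma dvdn_sum_sqr (p x y : nat) : prime p -> p %% 4 = 3 ->
  p %| x ^ 2 + y ^ 2 -> (p %| x) && (p %| y).
Proof.
move=> pp p4 pxy.
suff px : p %| x.
  by rewrite px /=; move: pxy; rewrite (dvdn_addr _ (dvdn_exp _ px)) // Euclid_dvdX // andbT.
apply/negPn/negP => px.
have F (z : nat) : ((z%:R : 'F_p) == 0)%R = (p %| z).
  by rewrite (dvdn_pcharf (pchar_Fp pp)).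
pose u : 'F_p := x%:R%R; pose v : 'F_p := y%:R%R.
have e : (u ^+ 2 = - v ^+ 2)%R.
  by apply/eqP; rewrite -addr_eq0 -!natrX -natrD F.
have u0 : (u != 0)%R by rewrite F.
have v0 : (v != 0)%R.
  apply: contraNneq u0 => v0; have := e.
  by rewrite v0 expr0n oppr0 => /eqP; rewrite sqrf_eq0.
have fer (w : 'F_p) : (w != 0 -> w ^+ p.-1 = 1)%R.
  move=> w0; apply: (mulfI w0); rewrite -exprS prednK ?prime_gt0 // mulr1.
  by have := expf_card w; rewrite card_Fp.
have hp : p.-1 = 2 * (p.-1)./2 by lia.
have oh : odd (p.-1)./2 by lia.
(* Raising [u ^+ 2 = - v ^+ 2] to the odd power [(p - 1) / 2] yields [1 = -1] by Fermat. *)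
have : ((u ^+ 2) ^+ (p.-1)./2 = 1)%R by rewrite -exprM -hp fer.
rewrite e exprNn -exprM -hp fer // mulr1 -signr_odd oh expr1 => /eqP.
rewrite eq_sym -subr_eq0 opprK -(natrD _ 1 1) F; move=> /dvdn_leq -/(_ isT); lia.
Qed.

Lemma dvdn_sqrD3sqr (p x y : nat) : prime p -> 3 < p -> p %% 3 = 2 ->
  p %| x ^ 2 + 3 * y ^ 2 -> (p %| x) && (p %| y).
Proof.
move=> pp p_gt3 p3 pxy.
have F (z : nat) : ((z%:R : 'F_p) == 0)%R = (p %| z).
  by rewrite (dvdn_pcharf (pchar_Fp pp)).
have p2 : ~~ (p %| 2) by apply/negP => /dvdn_leq; lia.
have n3 : ~~ (p %| 3) by apply/negP => /dvdn_leq; lia.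
suff py : p %| y.
  move: pxy; rewrite py andbT dvdn_addl; last by rewrite dvdn_mull // dvdn_exp.
  by rewrite Euclid_dvdX // andbT.
apply/negPn/negP => py.
pose t : 'F_p := (x%:R / y%:R)%R.
have t2 : (t ^+ 2 = - 3%:R)%R.
  apply/eqP; rewrite -addr_eq0 expr_div_n.
  have y0 : ((y%:R : 'F_p) ^+ 2 != 0)%R by rewrite expf_eq0 /= F.
  rewrite -(inj_eq (mulIf y0)) mulrDl mulfVK // mul0r.
  by rewrite -!natrX -natrM -natrD F.
have two0 : (2%:R != 0 :> 'F_p)%R by rewrite F.
(* w = (t - 1)/2 is a primitive cube root of unity, impossible as p = 2 mod 3 *)
pose w : 'F_p := ((t - 1) / 2%:R)%R.
have tw : (t = 2%:R * w + 1)%R by rewrite /w; field.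
have w2 : (w ^+ 2 = - w - 1)%R.
  have f0 : (4%:R != 0 :> 'F_p)%R by rewrite (natrM _ 2 2) mulf_neq0.
  apply: (mulfI f0); move: t2; rewrite tw => h.
  have -> : (4%:R * w ^+ 2 = (2%:R * w + 1) ^+ 2 - 4%:R * w - 1)%R by ring.
  by rewrite h; ring.
have w3 : (w ^+ 3 = 1)%R by rewrite exprS w2 mulrBr mulrN -expr2 w2; ring.
have := expf_card w; rewrite card_Fp //.
(* As [p] is 2 modulo 3, [w ^+ p = w ^+ 2], while Frobenius fixes [w]. Hence [w = - w - 1], so
   [t = 0] and [3 = 0]. *)
have -> : (w ^+ p = w ^+ (3 * (p %/ 3) + 2))%R by congr (_ ^+ _)%R; lia.
rewrite exprD exprM w3 expr1n mul1r.
rewrite w2 => h.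
have w' : (2%:R * w = -1)%R.
  have -> : (2%:R * w = w - (- w - 1) - 1)%R by ring.
  by rewrite h; ring.
move: t2; rewrite tw w' addNr expr0n /= => /eqP.
by rewrite eq_sym oppr_eq0 F (negPf n3).
Qed.

(** Descent: if [p] divides the value, both arguments are multiples of [p], so a factor [p ^ 2]
    splits off a smaller value of the same form. *)
Lemma odd_logn_anisotropic (p d x y : nat) : prime p ->
  (forall a b, p %| a ^ 2 + d * b ^ 2 -> (p %| a) && (p %| b)) ->
  odd (logn p (x ^ 2 + d * y ^ 2)) = false.
Proof.
move=> pp H; have [m] := ubnP (x ^ 2 + d * y ^ 2).
elim: m x y => // m IH x y hm.
have [h|h] := boolP (p %| x ^ 2 + d * y ^ 2); last first.
  by rewrite lognE (negPf h) !andbF.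
have [e0|pos] := posnP (x ^ 2 + d * y ^ 2); first by rewrite e0 logn0.
have /andP[/dvdnP[a ea] /dvdnP[b eb]] := H _ _ h.
have e : x ^ 2 + d * y ^ 2 = p ^ 2 * (a ^ 2 + d * b ^ 2) by rewrite ea eb; ring.
have p2 : 1 < p ^ 2 by rewrite -(exp1n 2) ltn_exp2r ?prime_gt1.
move: pos hm; rewrite e muln_gt0 => /andP[p0 pos'] hm.
rewrite lognM // pfactorK // oddD /= IH //.
move: hm; rewrite ltnS => /(leq_trans _); apply.
by rewrite -[X in X < _]mul1n ltn_pmul2r.
Qed.

(** * Congruence of polynomials modulo a power of X *)

Local Open Scope ring_scope.

(** Polynomials up to this congruence stand in for formal power series. *)
Definition eqXn (R : nzRingType) (K : nat) (p q : {poly R}) : Prop :=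
  forall i, (i < K)%N -> p`_i = q`_i.

Lemma eqXn_sym (R : nzRingType) K (p q : {poly R}) : eqXn K p q -> eqXn K q p.
Proof. by move=> h i /h. Qed.

Lemma eqXn_trans (R : nzRingType) K (p q r : {poly R}) :
  eqXn K p q -> eqXn K q r -> eqXn K p r.
Proof. by move=> h h' i iK; rewrite h ?h'. Qed.

Lemma eqXnM (R : nzRingType) K (p p' q q' : {poly R}) :
  eqXn K p p' -> eqXn K q q' -> eqXn K (p * q) (p' * q').
Proof.
move=> hp hq i iK; rewrite !coefM; apply: eq_bigr => j _.
by rewrite hp ?hq // (leq_ltn_trans _ iK) ?leq_subr // -ltnS.
Qed.

Lemma eqXn_mul1 (R : nzRingType) K (p q : {poly R}) :
  eqXn K p 1 -> eqXn K q 1 -> eqXn K (p * q) 1.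
Proof. by move=> hp hq; rewrite -[X in eqXn _ _ X](mulr1 1); apply: eqXnM. Qed.

Lemma eqXn_prod (R : comNzRingType) K I (r : seq I) (P : pred I) (F G : I -> {poly R}) :
  (forall i, P i -> eqXn K (F i) (G i)) ->
  eqXn K (\prod_(i <- r | P i) F i) (\prod_(i <- r | P i) G i).
Proof. by move=> h; elim/big_rec2: _ => // i p q Pi; apply: eqXnM; apply: h. Qed.

Lemma eqXn_addXn (R : nzRingType) K (p q r : {poly R}) (n : nat) : (K <= n)%N ->
  p = q + 'X^n * r -> eqXn K p q.
Proof.
move=> Kn -> i iK; rewrite coefD coefXnM (leq_trans iK Kn); exact: addr0.
Qed.

Lemma eqXn_mulI (R : comNzRingType) K (a p q : {poly R}) : a`_0 = 1 ->
  eqXn K (a * p) (a * q) -> eqXn K p q.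
Proof.
move=> a0 h i; elim/ltn_ind: i => i IH iK.
have := h i iK; rewrite !coefM !big_ord_recl /= subn0 a0 !mul1r.
have -> : \sum_(j < i) a`_(lift ord0 j) * p`_(i - lift ord0 j) =
          \sum_(j < i) a`_(lift ord0 j) * q`_(i - lift ord0 j).
  apply: eq_bigr => j _; have := ltn_ord j; rewrite lift0 => ji.
  by rewrite IH //; lia.
exact: addIr.
Qed.

(** * Finite q-products: pentagonal numbers and Euler's identity *)

Section Products.
Variable R : comNzRingType.
Implicit Types (n s i : nat).

Definition qprod s n : {poly R} := \prod_(s.+1 <= i < n.+1) (1 - 'X^i).

Lemma qprodnn n : qprod n n = 1.
Proof. by rewrite /qprod big_geq. Qed.

Lemma qprod_recr s n : (s <= n)%N -> qprod s n.+1 = qprod s n * (1 - 'X^(n.+1)).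
Proof. by move=> sn; rewrite /qprod big_nat_recr. Qed.

Lemma qprod_recl s n : (s < n)%N -> qprod s n = (1 - 'X^(s.+1)) * qprod s.+1 n.
Proof. by move=> sn; rewrite /qprod big_ltn. Qed.

(* Shanks: summed over [s <= n], these terms give the [n]-th partial sum of
   Euler's pentagonal series exactly; the term [s = 0] is [qprod 0 n] and the
   others are divisible by ['X^n.+1]. *)
Definition shanks n s : {poly R} :=
  (-1) ^+ s * qprod s n * 'X^(s * n + (s * s.+1)./2).

Lemma half_mulSn s : ((s.+1 * s.+2)./2 = (s * s.+1)./2 + s.+1)%N.
Proof.
have -> : (s.+1 * s.+2 = s * s.+1 + s.+1.*2)%N by lia.
by rewrite halfD odd_double andbF doubleK.
Qed.

(** Telescoping certificate for the change of [shanks n s] with [n]; its value 0 at [s = 0] leaves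
    only the upper boundary term. *)
Definition shanks_tele n s : {poly R} :=
  if s is s'.+1 then (-1) ^+ s * qprod s' n * 'X^(s * n + (s * s.+1)./2) else 0.

(** The term gains the factor ['X^s * (1 - 'X^n.+1) = 1 - (1 - 'X^s) - 'X^(n.+1 + s)]. For [s > 0],
    [1 - 'X^s] extends the product down to [qprod s.-1 n]. *)
Lemma shanks_step n s : (s <= n)%N ->
  shanks n.+1 s = shanks n s + (shanks_tele n s.+1 - shanks_tele n s).
Proof.
move=> sn; rewrite /shanks /shanks_tele.
have -> : (s * n.+1 + (s * s.+1)./2 = (s * n + (s * s.+1)./2) + s)%N by lia.
have -> : (s.+1 * n + (s.+1 * s.+2)./2 = (s * n + (s * s.+1)./2) + n.+1 + s)%N.
  by rewrite half_mulSn; lia.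
rewrite qprod_recr // !exprD [(-1) ^+ s.+1]exprS.
case: s sn => [|s] sn; first by rewrite ?expr0; ring.
by rewrite (qprod_recl sn); ring.
Qed.

Lemma sum_shanksS n : \sum_(0 <= s < n.+2) shanks n.+1 s =
  \sum_(0 <= s < n.+1) shanks n s + shanks_tele n n.+1 + shanks n.+1 n.+1.
Proof.
rewrite big_nat_recr //=; congr (_ + _).
under eq_big_nat => s /andP[_ sn] do rewrite shanks_step //.
by rewrite big_split /= telescope_sumr // subr0.
Qed.

(** Passing to [m = n.+1] adds two monomials, with pentagonal exponents [m(3m-1)/2] and [m(3m+1)/2];
    then [24 i + 1] is [(6m-1)^2] or [(6m+1)^2]. *)
Lemma sum_shanks_support n i :
  (\sum_(0 <= s < n.+1) shanks n s)`_i != 0 -> exists x, (24 * i + 1 = x ^ 2)%N.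
Proof.
elim: n => [|n IH].
  rewrite big_nat1 /shanks qprodnn !mul1r coef1.
  by case: i => [_|i]; [exists 1%N | rewrite /= eqxx].
have odd_sq a c : (((-1) ^+ c * 1 * 'X^a) : {poly R})`_i != 0 -> i = a.
  rewrite mulr1 -signr_odd; case: (odd c);
    rewrite ?expr1 ?expr0 ?mulN1r ?mul1r ?coefN coefXn; by case: (eqVneq i a) => [->|_] //;
    rewrite ?oppr0 ?eqxx.
rewrite sum_shanksS !coefD /shanks_tele /shanks !qprodnn.
have hh : (2 * (n.+1 * n.+2)./2 = n.+1 * n.+2)%N.
  by have := odd_double_half (n.+1 * n.+2); rewrite oddM /= negbK andNb; lia.
have [|z0] := boolP ((\sum_(0 <= s < n.+1) shanks n s)`_i != 0); first by move=> /IH.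
rewrite (eqP (negPn z0)) add0r.
set u := (X in X + _ != 0); have [->|/odd_sq -> _] := eqVneq u 0; last first.
  by exists (6 * n + 5)%N; nia.
rewrite add0r => /odd_sq ->.
by exists (6 * n + 7)%N; nia.
Qed.

Lemma qprod_support n i : (i <= n)%N ->
  (qprod 0 n)`_i != 0 -> exists x, (24 * i + 1 = x ^ 2)%N.
Proof.
move=> iN h; apply: (@sum_shanks_support n).
rewrite big_ltn // coefD coef_sum big_nat big1 ?addr0.
  by rewrite /shanks mul0n expr0 mul1r mulr1.
move=> s /andP[s0 sn]; rewrite /shanks coefMXn ifT //.
by case: s s0 {sn} => // s _; rewrite half_mulSn; lia.
Qed.

Lemma qprod_sqr n : qprod 0 n \Po 'X^2 = \prod_(1 <= i < n.+1) (1 - 'X^(2 * i)).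
Proof.
rewrite /qprod rmorph_prod; apply: eq_bigr => i _ /=.
by rewrite comp_polyB comp_polyC comp_Xn_poly exprM.
Qed.

Lemma qprod_sqr_support n i : (i <= n)%N ->
  (qprod 0 n \Po 'X^2)`_i != 0 -> exists x, (12 * i + 1 = x ^ 2)%N.
Proof.
move=> iN; rewrite coef_comp_poly_Xn //; case: ifP; last by rewrite eqxx.
move=> /dvdnP[a ia]; rewrite ia mulnK // => /qprod_support[|x e]; first by lia.
by exists x; rewrite -e; lia.
Qed.

Definition distprod n : {poly R} := \prod_(1 <= i < n.+1) (1 + 'X^i).

Lemma distprodM n : distprod n * qprod 0 n = qprod 0 n \Po 'X^2.
Proof.
rewrite qprod_sqr /distprod /qprod -big_split; apply: eq_bigr => i _ /=.
by rewrite mulnC exprM; ring.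
Qed.

Lemma qprod_parity L : qprod 0 L.*2 =
  \prod_(0 <= i < L) (1 - 'X^((2 * i).+1)) * (qprod 0 L \Po 'X^2).
Proof.
rewrite qprod_sqr; elim: L => [|L IH]; first by rewrite qprodnn !big_geq // mulr1.
rewrite doubleS !qprod_recr ?leq0n // IH (big_nat_recr L 0) //= (big_nat_recr L.+1 1) //=.
rewrite -mul2n; have -> : (2 * L.+1 = (2 * L).+2)%N by lia.
ring.
Qed.

(** Multiply by the even part [E] of [qprod 0 L.*2]: the left side becomes
    [distprod L.*2 * qprod 0 L.*2], which is [E] times factors [1 - 'X^(2 * i)] with [i > L],
    trivial modulo ['X^K]. *)
Lemma euler_odd_distinct K L : (K <= L)%N ->
  eqXn K (\prod_(0 <= i < L) (1 - 'X^((2 * i).+1)) * distprod L.*2) 1.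
Proof.
move=> KL; set O := \prod_(_ <= _ < _) _; pose E := qprod 0 L \Po 'X^2.
have E0 : E`_0 = 1.
  rewrite /E qprod_sqr big_nat coef0_prod big1 // => i /andP[i0 _].
  by rewrite coefB coef1 coefXn; case: i i0 => // i _; rewrite subr0.
apply: (eqXn_mulI E0).
have -> : E * (O * distprod L.*2) = E * \prod_(L.+1 <= i < L.*2.+1) (1 - 'X^(2 * i)).
  have -> : E * (O * distprod L.*2) = distprod L.*2 * (O * E) by ring.
  rewrite -qprod_parity distprodM qprod_sqr /E qprod_sqr.
  by rewrite -big_cat_nat //=; lia.
apply: eqXnM => //; rewrite big_nat.
elim/big_rec: _ => // i p /andP[Li _]; apply: eqXn_mul1.
by apply: (@eqXn_addXn _ _ _ _ (-1) (2 * i)); [lia | rewrite mulrN1].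
Qed.

End Products.

Lemma coefM_neq0 (R : nzRingType) (p q : {poly R}) n : (p * q)`_n != 0 ->
  exists a b, [/\ n = (a + b)%N, p`_a != 0 & q`_b != 0].
Proof.
move=> h.
have [/existsP[a /andP[ha hb]]|] :=
  boolP [exists a : 'I_n.+1, (p`_a != 0) && (q`_(n - a) != 0)].
  by exists a, (n - a)%N; split=> //; have := ltn_ord a; lia.
rewrite negb_exists => /forallP z; case/eqP: h; rewrite coefM big1 // => a _.
by have := z a; rewrite negb_and !negbK => /orP[/eqP->|/eqP->]; rewrite ?mul0r ?mulr0.
Qed.

(** * Generating function of partitions into odd parts *)

Section OddPartitionSeries.
Variable R : comNzRingType.

Definition odd_partition_series K m : {poly R} :=
  \poly_(i < K) (odd_partition_count m i)%:R.

(** Raising the bound by 2 admits one new odd part, [2i+1], which contributes the factor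
    [1 / (1 - q^(2i+1))]. *)
Lemma odd_partition_series_step K i :
  eqXn K ((1 - 'X^((2 * i).+1)) * odd_partition_series K (2 * i.+1))
         (odd_partition_series K (2 * i)).
Proof.
move=> j jK; rewrite mulrBl mul1r coefB coefXnM !coef_poly jK.
have -> : (2 * i.+1 = (2 * i).+2)%N by lia.
have e (n : nat) : odd_partition_count (2 * i).+2 n = odd_partition_count (2 * i).+1 n.
  by rewrite odd_partition_countS /= negbK oddM /= addn0.
rewrite !e {1}odd_partition_countS /= oddM /= ltnNge ltnS -ltnNge.
case: ifP => h; last by rewrite addn0 ifT ?subr0 //; lia.
by rewrite ifF ?ifT ?natrD ?addrK //; lia.
Qed.

Lemma odd_partition_seriesM K L :
  eqXn K (\prod_(0 <= i < L) (1 - 'X^((2 * i).+1)) * odd_partition_series K (2 * L)) 1.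
Proof.
elim: L => [|L IH].
  rewrite big_geq // mul1r => i iK.
  by rewrite coef_poly iK coef1 odd_partition_count0.
apply: eqXn_trans IH; rewrite big_nat_recr //= -mulrA.
by apply: eqXnM => //; apply: odd_partition_series_step.
Qed.

(** Both sides are inverse to [O] modulo ['X^K]. *)
Lemma odd_partition_series_distprod K L : (K <= L)%N ->
  eqXn K (odd_partition_series K (2 * L)) (distprod R L.*2).
Proof.
move=> KL; set O : {poly R} := \prod_(0 <= i < L) (1 - 'X^((2 * i).+1)).
apply: (@eqXn_mulI _ _ O).
  by rewrite /O coef0_prod big1 // => i _; rewrite coefB coef1 coefXn subr0.
apply: (eqXn_trans (@odd_partition_seriesM K L)).
exact/eqXn_sym/euler_odd_distinct.
Qed.

Lemma B2_nat_coef n L : (n < L)%N ->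
  (B2_nat n)%:R = (distprod R L.*2 ^+ 2)`_n.
Proof.
move=> nL; have h := odd_partition_series_distprod nL.
rewrite expr2 -(eqXnM h h) // coefM (@B2_nat_convolution (2 * L)); last by lia.
rewrite natr_sum; apply: eq_bigr => a _; rewrite !coef_poly natrM.
by rewrite ltn_ord ltnS leq_subr.
Qed.

End OddPartitionSeries.

(** * Two evaluations of the generating function modulo 4 *)

Section Mod4.
Variable R : comNzRingType.
Hypothesis four0 : 4%:R = 0 :> R.

Let polyfour0 : 4%:R = 0 :> {poly R}.
Proof. by rewrite -polyC_natr four0. Qed.

Lemma distprod_mod2 n : exists h, distprod R n = qprod R 0 n + 2%:R * h.
Proof.
rewrite /distprod /qprod; elim: n => [|n [h e]]; first by exists 0; rewrite !big_geq // mulr0 addr0.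
exists (h * (1 + 'X^(n.+1)) + (\prod_(1 <= i < n.+1) (1 - 'X^i)) * 'X^(n.+1)).
by rewrite !(@big_nat_recr _ _ _ n.+1 1) //= e; ring.
Qed.

Lemma distprod_sqr n : distprod R n ^+ 2 = qprod R 0 n ^+ 2.
Proof.
have [h ->] := distprod_mod2 n.
have -> : (qprod R 0 n + 2%:R * h) ^+ 2 =
  qprod R 0 n ^+ 2 + 4%:R * (qprod R 0 n * h + h ^+ 2) by ring.
by rewrite polyfour0 mul0r addr0.
Qed.

(** Truncation of [q^i / (1 - q^i)], for use in [(1 + x) / (1 - x) = 1 + 2x / (1 - x)]. *)
Definition geom K i : {poly R} := \sum_(1 <= j < K) 'X^(i * j).

Lemma geom_eq K i : (0 < i)%N ->
  eqXn K (1 + 'X^i) ((1 - 'X^i) * (1 + 2%:R * geom K i)).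
Proof.
move=> i0; case: K => [|K] //.
have e : (1 - 'X^i) * geom K.+1 i = 'X^i - 'X^(i * K.+1).
  rewrite /geom; elim: K => [|K IH]; first by rewrite big_geq // mulr0 muln1 subrr.
  by rewrite big_nat_recr //= mulrDr IH mulrBl mul1r -exprD -mulnS; ring.
apply: (@eqXn_addXn _ _ _ _ 2%:R (i * K.+1)); first by nia.
have -> : (1 - 'X^i) * (1 + 2%:R * geom K.+1 i) =
  1 - 'X^i + 2%:R * ((1 - 'X^i) * geom K.+1 i) by ring.
by rewrite e; ring.
Qed.

Lemma prod_1D2 (f : nat -> {poly R}) n :
  \prod_(1 <= i < n.+1) (1 + 2%:R * f i) = 1 + 2%:R * \sum_(1 <= i < n.+1) f i.
Proof.
elim: n => [|n IH]; first by rewrite !big_geq // mulr0 addr0.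
rewrite !(@big_nat_recr _ _ _ n.+1 1) //= IH.
set s := \sum_(_ <= _ < _) _; have -> : (1 + 2%:R * s) * (1 + 2%:R * f n.+1) =
  1 + 2%:R * (s + f n.+1) + 4%:R * (s * f n.+1) by ring.
by rewrite polyfour0 mul0r addr0.
Qed.

Lemma sum_symmetric (f : nat -> nat -> {poly R}) n : (forall i j, f i j = f j i) ->
  exists t, \sum_(1 <= i < n.+1) \sum_(1 <= j < n.+1) f i j =
            \sum_(1 <= i < n.+1) f i i + 2%:R * t.
Proof.
move=> fC; elim: n => [|n [t IH]]; first by exists 0; rewrite !big_geq // mulr0 addr0.
exists (t + \sum_(1 <= j < n.+1) f n.+1 j).
rewrite !(@big_nat_recr _ _ _ n.+1 1) //=.
under eq_bigr => i _ do rewrite (@big_nat_recr _ _ _ n.+1 1) //= (fC i n.+1).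
by rewrite big_split /= IH; ring.
Qed.

(* [distprod / qprod] is the product of [(1 + q^i) / (1 - q^i)], which is
   [1 + 2 * \sum_i q^i / (1 - q^i)] modulo 4; in the Lambert series
   [\sum_(i, j) q^(i * j)] the terms with [i <> j] pair up. *)
Lemma distprod_theta n :
  eqXn n.+1 (distprod R n)
    (qprod R 0 n * (1 + 2%:R * \sum_(1 <= i < n.+1) 'X^(i ^ 2))).
Proof.
have [t e] := sum_symmetric n (fun i j => congr1 (fun m => 'X^m) (mulnC i j)).
have -> : 1 + 2%:R * \sum_(1 <= i < n.+1) 'X^(i ^ 2) =
    \prod_(1 <= i < n.+1) (1 + 2%:R * geom n.+1 i).
  rewrite prod_1D2 [in RHS]e; congr (1 + _).
  (* The off-diagonal terms contribute [2 * (2 * t) = 0]. *)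
  rewrite mulrDr mulrA -natrM polyfour0 mul0r addr0.
  by under [in RHS]eq_bigr => i _ do rewrite mulnn.
rewrite /qprod -big_split /= /distprod !big_nat.
by apply: eqXn_prod => i /andP[i0 _]; apply: geom_eq.
Qed.

(** Some [a + b = n] are both pentagonal; add [24 a + 1 = x ^ 2] and [24 b + 1 = y ^ 2]. *)
Lemma B2_nat_sum_sqr n : (B2_nat n)%:R != 0 :> R ->
  exists x y, (2 * (12 * n + 1) = x ^ 2 + y ^ 2)%N.
Proof.
rewrite (B2_nat_coef R (ltnSn n)) distprod_sqr expr2.
case/coefM_neq0 => a [b [e]].
move=> /qprod_support[|x ex]; first by lia.
by move=> /qprod_support[|y ey]; [lia | exists x, y; lia].
Qed.

Lemma B2_nat_sqrD12sqr n : (B2_nat n)%:R != 0 :> R ->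
  exists x y, (12 * n + 1 = x ^ 2 + 12 * y ^ 2)%N.
Proof.
rewrite (B2_nat_coef R (ltnSn n)) expr2.
have h : eqXn n.+1 (distprod R n.+1.*2) (distprod R n.+1.*2) by [].
(* Only one of the two factors is expanded; the other meets [qprod] and gives [qprod] at ['X^2]. So
   [n = a + b] with [12 a + 1] a square and [b] a square, possibly 0. *)
rewrite (eqXnM h (fun i i_lt => @distprod_theta _ i (leq_trans i_lt _))); try lia.
rewrite mulrA distprodM; case/coefM_neq0 => a [b [e]].
move=> /qprod_sqr_support[|x ex]; first by lia.
have [b0|b0] := eqVneq b 0%N; first by move=> _; exists x, 0%N; lia.
rewrite coefD coef1 (negPf b0) add0r mulr_natl coefMn coef_sum.
have [s|] := boolP [exists y : 'I_b.+1, (y ^ 2 == b)%N].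
  by case/existsP: s => y /eqP ey _; exists x, y; lia.
rewrite negb_exists => /forallP ns; rewrite big1 ?mul0rn ?eqxx // => i _.
rewrite coefXn; case: eqVneq => // bi.
have ib : (i < b.+1)%N by nia.
by have := ns (Ordinal ib); rewrite /= -bi eqxx.
Qed.

End Mod4.

(** * The valuation of 12n + 1 and the final congruence *)

Lemma B2_nat_mod4 (n p : nat) : prime p -> ~~ (p %| 12)%N -> (p %% 12 != 1)%N ->
  odd (logn p (12 * n + 1)) -> (B2_nat n = 0 %[mod 4])%N.
Proof.
move=> pp p12 p1 lp; apply/eqP; apply: contraTT lp => B.
have {}B : ((B2_nat n)%:R != 0 :> 'Z_4) by rewrite -(inj_eq val_inj) /= val_Zp_nat.
have four0 : 4%:R = 0 :> 'Z_4 by rewrite pchar_Zp.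
have n2 : ~~ (2 %| p)%N.
  by apply: contra p12; rewrite dvdn_prime2 // => /eqP <-.
have n3 : ~~ (3 %| p)%N.
  by apply: contra p12; rewrite dvdn_prime2 // => /eqP <-.
have p3 : (3 < p)%N by move: (prime_gt1 pp); lia.
(* Here [p] is 5, 7 or 11 modulo 12. If it is not 3 modulo 4, it is 5 modulo 12, hence 2 modulo
   3. *)
have [/eqP p4|p4] := boolP (p %% 4 == 3)%N.
  have [x [y e]] := B2_nat_sum_sqr four0 B.
  have := @odd_logn_anisotropic p 1 x y pp.
  rewrite mul1n -e logn_Gauss => [-> //|]; last first.
    by rewrite coprime_sym prime_coprime // gtnNdvd //; lia.
  by move=> a b; rewrite mul1n; apply: dvdn_sum_sqr.
have [x [y e]] := B2_nat_sqrD12sqr four0 B.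
have := @odd_logn_anisotropic p 3 x (2 * y) pp.
have -> : (x ^ 2 + 3 * (2 * y) ^ 2 = 12 * n + 1)%N by rewrite e; lia.
by move=> -> // a b; apply: dvdn_sqrD3sqr => //; lia.
Qed.

Theorem theorem1p4 (k n : nat) (p : nat -> nat) (j : int)
    (n_gt0 : (0 < n)%N)
    (p_prime : forall i : nat, (1 <= i <= k.+1)%N -> prime (p i))
    (p_mod12 : forall i : nat, (1 <= i <= k.+1)%N -> p i <> 1 %[mod 12])
    (j_mod : (j <> 0 %[mod (p k.+1)%:Z])%Z) :
  B2 ((\prod_(1 <= i < k.+1) (p i)%:R ^+ 2) * (p k.+1)%:R ^+ 2 * n%:R
      + ((\prod_(1 <= i < k.+1) (p i)%:R ^+ 2) * (p k.+1)%:R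
           * (12%:R * j%:~R + (p k.+1)%:R) - 1) / 12%:R)
    = 0 %[mod 4].
Proof.
(* Off the natural numbers [B2] is 0; otherwise the argument is some [N]. *)
set x := (X in B2 X); rewrite /B2; case: ifP => // /natrP[N xN].
rewrite xN natrK.
have pk : (1 <= k.+1 <= k.+1)%N by rewrite leqnn.
have := p_prime _ pk; have := p_mod12 _ pk; move: j_mod xN; rewrite /x.
move: (p k.+1) => q j_mod xN q1 q_prime.
pose P := (\prod_(1 <= i < k.+1) p i)%N.
have P_gt0 : (0 < P)%N.
  by rewrite /P big_nat prodn_cond_gt0 // => i /andP[i0 ik];
    rewrite prime_gt0 // p_prime // i0 ltnW.
have PE : \prod_(1 <= i < k.+1) (p i)%:R ^+ 2 = P%:R ^+ 2 :> rat.
  by rewrite prodrXl natr_prod.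
rewrite PE in xN.
(* Clearing denominators, [12 N + 1 = P ^ 2 * q * w]; positivity of the left side forces [w > 0]
   even for negative [j]. *)
pose w : int := 12%:R * (q * n)%N%:Z + 12%:R * j + q%:Z.
have Nw : 12%:R * N%:Z + 1 = (P ^ 2 * q)%N%:Z * w.
  apply: (@intr_inj rat); rewrite /w !(rmorphD, rmorphM, rmorph1) /=.
  by rewrite -!pmulrn -xN; field.
have w_gt0 : 0 < w.
  have : 0 < (P ^ 2 * q)%N%:Z * w by rewrite -Nw; lia.
  by rewrite pmulr_rgt0 // ltz_nat muln_gt0 expn_gt0 P_gt0 prime_gt0.
(* If [q] were 2 or 3, it would divide both [12 N] and [12 N + 1]. *)
have q12 : ~~ (q %| 12)%N.
  apply/negP => q12; have : (q%:Z %| 12%:R * N%:Z + 1)%Z.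
    by rewrite Nw PoszM -mulrA dvdz_mull // dvdz_mulr.
  have q12N : (q%:Z %| 12%:R * N%:Z)%Z by exact: dvdz_mulr.
  rewrite (rpredDl _ q12N) => /dvdn_leq -/(_ isT).
  by have := prime_gt1 q_prime; lia.
have qw : ~~ (q %| w)%Z.
  have qn : (q %| 12%:R * (q * n)%N%:Z)%Z by rewrite dvdz_mull // PoszM dvdz_mulr.
  rewrite /w (rpredDr _ (dvdzz q)) (rpredDl _ qn).
  rewrite Gauss_dvdzr; last by rewrite coprimezE prime_coprime.
  by apply/negP => qj; apply: j_mod; rewrite mod0z; apply/dvdz_mod0P.
case: w w_gt0 qw Nw => // w' w'_gt0 qw Nw.
apply: (B2_nat_mod4 q_prime q12); first by apply/eqP.
have -> : (12 * N + 1 = P ^ 2 * (q * w'))%N by lia.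
have {}qw : ~~ (q %| w')%N by [].
have {}w'_gt0 : (0 < w')%N by [].
have q_gt0 := prime_gt0 q_prime.
(* [q] may also occur in [P], but the square contributes evenly; the single factor [q] makes the
   valuation odd, as [q] does not divide [w']. *)
rewrite lognM ?expn_gt0 ?muln_gt0 ?P_gt0 ?q_gt0 // lognX lognM //.
by rewrite (logn_prime q q_prime) eqxx oddD oddM /= lognE (negPf qw) !andbF.
Qed.
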